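(* Let $q\in\mathbb N$, let $\alpha_1,\dots,\alpha_{2q}$, $\beta_1,\dots,\beta_{2q}$, $x_1,\dots,x_{2q}$ be complex numbers, and let $\Lambda$ be the associated block Vandermonde matrix of order $2q$. Then $$\det\Lambda=\sum_{\substack{T\subseteq[2q]\\|T|=q}}\varepsilon(T)\left(\prod_{i\in T}\alpha_i\right)\left(\prod_{j\in T^c}\beta_j\right)\det(V_T)\det(V_{T^c}),$$ where, for each $T=\{t_1<\cdots<t_q\}$ with complement $T^c=[2q]\setminus T=\{u_1<\cdots<u_q\}$, $$\varepsilon(T):=(-1)^{\sum_{k=1}^q(t_k-k)}.$$ Equivalently, $$\det\Lambda=\sum_{\substack{T\subseteq[2q]\\|T|=q}}\varepsilon(T)\left(\prod_{i\in T}\alpha_i\right)\left(\prod_{j\in T^c}\beta_j\right)\prod_{1\le i<j\le q}(x_{t_j}-x_{t_i})\prod_{1\le i<j\le q}(x_{u_j}-x_{u_i}).$$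
   Context: $[2q]=\{1,\dots,2q\}$. The block Vandermonde matrix of order $2q$ is the $2q\times2q$ matrix $\Lambda$ whose $i$-th row is $$(\alpha_i,\ \alpha_ix_i,\ \dots,\ \alpha_ix_i^{q-1},\ \beta_i,\ \beta_ix_i,\ \dots,\ \beta_ix_i^{q-1}),\qquad i=1,\dots,2q.$$ For $T=\{t_1<\cdots<t_m\}\subseteq[2q]$, $V_T=(x_{t_i}^{j-1})_{1\le i,j\le m}$ is the square Vandermonde matrix associated with $T$. *)

(* Defs.v *)
From HB Require Import structures.
From mathcomp Require Import all_boot all_order all_algebra.
From mathcomp Require Import reals complex.

Set Implicit Arguments.
Unset Strict Implicit.
Unset Printing Implicit Defensive.

Import Order.TTheory GRing.Theory Num.Theory.
Local Open Scope ring_scope.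

(* All indices are 0-based: the set {1, ..., n} is rendered by 'I_n, so the
   exponents j - 1 of the usual 1-based notation become j. *)

Definition block_vandermonde (K : comNzRingType) (q : nat)
    (alpha beta x : 'I_(2 * q) -> K) : 'M[K]_(2 * q) :=
  \matrix_(i, j) if (j < q)%N then alpha i * x i ^+ j
                 else beta i * x i ^+ (j - q).

(* The elements t_0 < t_1 < ... of T are listed by enum_val; the next lemma
   records that this enumeration is increasing. *)
Definition elt (n : nat) (T : {set 'I_n}) (k : 'I_#|T|) : 'I_n := enum_val k.

Lemma ltn_elt (n : nat) (T : {set 'I_n}) (k l : 'I_#|T|) :
  (k < l)%N -> (elt k < elt l)%N.
Proof.
move=> lt_kl.
have srt : sorted ltn (map val (enum T)).
  suff -> : enum T = [seq i <- enum 'I_n | i \in T].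
    apply: (subseq_sorted ltn_trans _ (iota_ltn_sorted 0 n)).
    by rewrite -val_enum_ord map_subseq ?filter_subseq.
  by rewrite enumT.
have size_enum (m : 'I_#|T|) : (m < size (enum T))%N by rewrite -cardE.
have nth_elt (m : 'I_#|T|) : nth 0%N (map val (enum T)) m = elt m.
  by rewrite [in RHS]/elt (enum_val_nth (elt m)) (nth_map (elt m)).
rewrite -!nth_elt; apply: (sorted_ltn_nth ltn_trans) => //.
  by rewrite inE size_map size_enum.
by rewrite inE size_map size_enum.
Qed.

(* mathcomp's Vandermonde matrix has the powers of a single point in each
   column, hence the transposition: the (i, j) entry is (x t_i) ^+ j. *)
Definition vandermonde_of (K : comNzRingType) (n : nat) (x : 'I_n -> K)
    (T : {set 'I_n}) : 'M[K]_#|T| :=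
  (Vandermonde #|T| (\row_(i < #|T|) x (elt i)))^T.

(* The offset t_k - k does not depend on whether both are counted from 0 or
   from 1, and it is never truncated since k <= t_k. *)
Definition eps (K : comNzRingType) (n : nat) (T : {set 'I_n}) : K :=
  (-1) ^+ (\sum_(k < #|T|) (elt k - k))%N.

Definition diff_prod (K : comNzRingType) (n : nat) (x : 'I_n -> K)
    (T : {set 'I_n}) : K :=
  \prod_(i < #|T|) \prod_(j < #|T| | (i < j)%N) (x (elt j) - x (elt i)).

(* Main.v *)
Require Import Defs.
From HB Require Import structures.
From mathcomp Require Import all_boot all_order all_fingroup all_algebra.
From mathcomp Require Import reals complex.

Set Implicit Arguments.
Unset Strict Implicit.
Unset Printing Implicit Defensive.

Import Order.TTheory GRing.Theory Num.Theory.
Local Open Scope ring_scope.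
Local Open Scope complex_scope.

(** Both formulas are instances of the Laplace expansion of a determinant along
    a block of leading columns.  In the Leibniz sum, a permutation [s] of the
    [n] indices determines the set [T] of rows that it sends into the first [p]
    columns, and [#|T| = p].  The terms attached to a fixed [T] make up the
    determinant of the matrix obtained by keeping, in the rows of [T], only the
    first [p] entries, and in the other rows only the last [n - p] ones
    ([det_split_rows]).  Listing the rows of [T] in increasing order, followed
    by those of [~: T], turns this matrix into a block-diagonal one, whose
    determinant is a product of two minors; this is [det_laplace].

    The sign is that of the permutation listing [T] and then [~: T].  A
    permutation has the sign given by its number of inversions
    ([sign_perm_inversions]), and here the inversions are the pairs of a [t] in
    [T] and a smaller [u] outside [T].  Among the [t_k] indices below [t_k],
    exactly [k] belong to [T], so [t_k] takes part in [t_k - k] inversions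
    ([elt_rank]), which gives [eps].

    In the block Vandermonde matrix the two minors are Vandermonde matrices with
    row [i] multiplied by [alpha i] or [beta i]; taking these factors out
    proves the first formula, and the product formula for Vandermonde
    determinants the second. *)

(** * The sign of a permutation and its inversions *)

Definition inversions (m n : nat) (h : 'I_m -> 'I_n) : nat :=
  (\sum_(i < m) \sum_(j < m | i < j) (h j < h i))%N.

(** Permuting the columns of the Vandermonde matrix of 0, ..., n - 1 multiplies
    its determinant by the sign of the permutation.  As a product of
    differences, the permuted determinant has one negative factor for each
    inversion, so that comparing signs in the integers gives the result, which
    is then transported to any ring. *)
Lemma sign_perm_inversions (K : comNzRingType) (n : nat) (s : 'S_n) :
  (-1) ^+ s = (-1) ^+ inversions s :> K.
Proof.
suff sgE : (-1) ^+ s = (-1) ^+ inversions s :> int.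
  by have := congr1 (intr : int -> K) sgE; rewrite !rmorph_sign.
pose V (f : 'I_n -> 'I_n) : 'M[int]_n := Vandermonde n (\row_j (f j)%:R).
have sgV f : injective f -> Num.sg (\det (V f)) = (-1) ^+ inversions f.
  move=> f_inj; rewrite det_Vandermonde expr_sum.
  rewrite (big_morph _ (@sgrM _) (@sgr1 _)); apply: eq_bigr => i _.
  rewrite (big_morph _ (@sgrM _) (@sgr1 _)) expr_sum; apply: eq_bigr => j lt_ij.
  rewrite !mxE; have [lt_f | lt_f | eq_f] := ltngtP (f j) (f i).
  - by apply: ltr0_sg; rewrite subr_lt0 ltr_nat.
  - by apply: gtr0_sg; rewrite subr_gt0 ltr_nat.
  - by rewrite (f_inj _ _ (val_inj eq_f)) ltnn in lt_ij.
have inv_id : inversions (@id 'I_n) = 0%N.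
  by rewrite /inversions big1 // => i _; rewrite big1 // => j; case: ltngtP.
have Vs : V s = col_perm s (V id) by apply/matrixP=> i j; rewrite !mxE.
have := sgV s (@perm_inj _ s).
rewrite Vs col_permE det_mulmx det_perm odd_permV sgrM sgV // inv_id.
by rewrite mul1r => <-; rewrite sgrX sgrN1.
Qed.

Lemma sum_ltn_ord (n p : nat) : (p <= n)%N -> (\sum_(i < n) (i < p) = p)%N.
Proof.
move=> le_pn.
rewrite -[RHS]card_ord -sum1_card (big_ord_widen n (fun=> 1%N) le_pn).
by rewrite [RHS]big_mkcond; apply: eq_bigr => i _; case: ltnP.
Qed.

(** Allowing [m] and [n] to be merely propositionally equal lets the rows be
    listed by a concatenation of two enumerations, whose length is a sum. *)
Lemma det_rows (K : comNzRingType) (m n : nat) (eq_mn : m = n)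
    (h : 'I_m -> 'I_n) (A : 'M[K]_n) : injective h ->
  \det (\matrix_(i < m, j < m) A (h i) (cast_ord eq_mn j)) =
    (-1) ^+ inversions h * \det A.
Proof.
case: n / eq_mn h A => h A h_inj.
have hE : h =1 perm h_inj by move=> i; rewrite permE.
have -> : inversions h = inversions (perm h_inj).
  by apply: eq_bigr => i _; apply: eq_bigr => j _; rewrite !hE.
rewrite -sign_perm_inversions -det_perm -det_mulmx -row_permE.
by congr (\det _); apply/matrixP=> i j; rewrite !mxE cast_ord_id hE.
Qed.

(** * Splitting the rows between two blocks of columns *)

(** Leibniz terms are grouped by the set of rows sent to the first [p] columns.
    In the determinant attached to [T], the permutations from the other groups
    meet a zero entry. *)
Lemma det_split_rows (K : comNzRingType) (n p : nat) (A : 'M[K]_n) :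
    (p <= n)%N ->
  \det A = \sum_(T : {set 'I_n} | #|T| == p)
    \det (\matrix_(i, j) if (i \in T) == (j < p)%N then A i j else 0).
Proof.
move=> le_pn; rewrite [LHS]/determinant.
rewrite (partition_big (fun s : 'S_n => [set i | (s i < p)%N])
           (fun T => #|T| == p)) => [|s _] /=; last first.
  have -> : [set i | (s i < p)%N] = s @^-1: [set j : 'I_n | (j < p)%N].
    by apply/setP=> i; rewrite !inE.
  rewrite card_preimset; last exact: perm_inj.
  by rewrite -sum1dep_card big_mkcond /= -[X in _ == X](sum_ltn_ord le_pn).
apply: eq_bigr => T _; rewrite big_mkcond; apply: eq_bigr => s _.
case: eqP => [<- | neT].
  by congr (_ * _); apply: eq_bigr => i _; rewrite !mxE inE eqxx.
have [i ne_i] : exists i, (i \in T) != (s i < p)%N.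
  apply/existsP; apply: contra_notT neT; rewrite negb_exists => /forallP eqT.
  by apply/setP=> i; rewrite inE; have := eqT i; rewrite negbK => /eqP.
by rewrite [X in _ * X](bigD1 i) //= mxE (negPf ne_i) mul0r mulr0.
Qed.

(** * Listing a set and then its complement *)

Definition shuffle (n : nat) (T : {set 'I_n})
    (k : 'I_(#|T| + #|~: T|)) : 'I_n :=
  match split k with inl i => elt i | inr j => elt j end.

Lemma shuffle_lshift (n : nat) (T : {set 'I_n}) (i : 'I_#|T|) :
  shuffle (lshift #|~: T| i) = elt i.
Proof. by rewrite /shuffle (unsplitK (inl i)). Qed.

Lemma shuffle_rshift (n : nat) (T : {set 'I_n}) (j : 'I_#|~: T|) :
  shuffle (rshift #|T| j) = elt j.
Proof. by rewrite /shuffle (unsplitK (inr j)). Qed.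

Lemma elt_in (n : nat) (T : {set 'I_n}) (i : 'I_#|T|) : elt i \in T.
Proof. exact: enum_valP. Qed.

Lemma elt_inC (n : nat) (T : {set 'I_n}) (j : 'I_#|~: T|) :
  (elt j \in T) = false.
Proof. by have := elt_in j; rewrite inE => /negPf. Qed.

Lemma shuffle_inj (n : nat) (T : {set 'I_n}) : injective (@shuffle n T).
Proof.
move=> k l; case: (split_ordP k) => i ->; case: (split_ordP l) => j ->;
  rewrite ?shuffle_lshift ?shuffle_rshift => eq_ij.
- by rewrite (enum_val_inj eq_ij).
- by have := elt_in i; rewrite eq_ij elt_inC.
- by have := elt_in j; rewrite -eq_ij elt_inC.
- by rewrite (enum_val_inj eq_ij).
Qed.

Lemma card_setC_ord (n : nat) (T : {set 'I_n}) : (#|T| + #|~: T| = n)%N.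
Proof. by rewrite cardsC card_ord. Qed.

Lemma elt_ltn (n : nat) (T : {set 'I_n}) (k l : 'I_#|T|) :
  (elt k < elt l)%N = (k < l)%N.
Proof.
case: (ltngtP k l) => [/ltn_elt -> // | /ltn_elt /ltnW | /val_inj ->].
  by rewrite leqNgt => /negPf.
exact: ltnn.
Qed.

(** The [elt i] indices below [elt i] are the [i] preceding elements of [T],
    together with the elements of the complement that are below [elt i]. *)
Lemma elt_rank (n : nat) (T : {set 'I_n}) (i : 'I_#|T|) :
  (elt i - i = \sum_(j < #|~: T|) (elt j < elt i))%N.
Proof.
have below : (\sum_(k < #|T| + #|~: T|) (shuffle k < elt i))%N = elt i.
  rewrite -[RHS](sum_ltn_ord (ltnW (ltn_ord (elt i)))).
  rewrite [RHS](reindex (@shuffle n T)) //=.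
  apply: onW_bij; apply: inj_card_bij; first exact: shuffle_inj.
  by rewrite !card_ord card_setC_ord.
rewrite -[X in (X - _)%N]below big_split_ord /=.
under eq_bigr do rewrite shuffle_lshift elt_ltn.
rewrite (sum_ltn_ord (ltnW (ltn_ord i))) addKn.
by apply: eq_bigr => j _; rewrite shuffle_rshift.
Qed.

(** Both enumerations are increasing, so an inversion pairs an element of [T]
    with a smaller element of the complement. *)
Lemma inversions_shuffle (n : nat) (T : {set 'I_n}) :
  inversions (@shuffle n T) = (\sum_(k < #|T|) (elt k - k))%N.
Proof.
rewrite /inversions big_split_ord /= [X in (_ + X)%N]big1 ?addn0 => [|j _].
  apply: eq_bigr => i _; rewrite big_mkcond big_split_ord /= big1 ?add0n.
    rewrite elt_rank; apply: eq_bigr => j _.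
    by rewrite shuffle_lshift shuffle_rshift ltn_addr.
  move=> k _; rewrite !shuffle_lshift elt_ltn.
  by case: (ltngtP i k).
rewrite big_mkcond big_split_ord /= !big1 // => k _.
  by rewrite !shuffle_rshift elt_ltn ltn_add2l; case: (ltngtP j k).
by rewrite ltnNge ltnW //= ltn_addr.
Qed.

(** * Laplace expansion along the leading columns *)

(** The two column blocks are given by functions of a natural number column
    index, so that the same function fills a block of columns of the matrix and
    a minor whose size is the cardinal of a set; these sizes are equal but not
    convertible. *)
Lemma det_laplace (K : comNzRingType) (n p : nat) (f g : 'I_n -> nat -> K) :
    (p <= n)%N ->
  \det (\matrix_(i < n, j < n) if (j < p)%N then f i j else g i (j - p)%N) =
    \sum_(T : {set 'I_n} | #|T| == p)
      eps K T * \det (\matrix_(i < #|T|, j < #|T|) f (elt i) j)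
        * \det (\matrix_(i < #|~: T|, j < #|~: T|) g (elt i) j).
Proof.
move=> /det_split_rows ->; apply: eq_bigr => T /eqP <-.
set A := \matrix_(i, j) _.
rewrite -mulrA -(det_lblock _ 0) -[\det A]mul1r.
(* The sign moves to the other side, where it is the effect of [shuffle]. *)
have <- : eps K T * eps K T = 1 by rewrite -expr2 sqrr_sign.
rewrite -mulrA; congr (_ * _).
rewrite {1}/eps -inversions_shuffle.
rewrite -(det_rows (card_setC_ord T) _ (@shuffle_inj _ T)).
congr (\det _); apply/matrixP=> k l; rewrite mxE.
case: (split_ordP k) => i ->; case: (split_ordP l) => j ->;
  rewrite ?block_mxEul ?block_mxEur ?block_mxEdl ?block_mxEdr;
  rewrite ?shuffle_lshift ?shuffle_rshift !mxE ?elt_in ?elt_inC /= ?ltn_ord //=;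
  by rewrite ltnNge leq_addr //= addKn.
Qed.

(** * Block Vandermonde determinants *)

Lemma det_scaled_powers (K : comNzRingType) (n : nat) (a x : 'I_n -> K)
    (T : {set 'I_n}) :
  \det (\matrix_(i < #|T|, j < #|T|) (a (elt i) * x (elt i) ^+ j)) =
    (\prod_(i in T) a i) * \det (vandermonde_of x T).
Proof.
have -> : \matrix_(i < #|T|, j < #|T|) (a (elt i) * x (elt i) ^+ j) =
    diag_mx (\row_i a (elt i)) *m vandermonde_of x T.
  by apply/matrixP=> i j; rewrite mul_diag_mx !mxE.
rewrite det_mulmx det_diag; congr (_ * _); rewrite [RHS]big_enum_val.
by apply: eq_bigr => i _; rewrite mxE.
Qed.

Lemma det_vandermonde_of (K : comNzRingType) (n : nat) (x : 'I_n -> K)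
    (T : {set 'I_n}) : \det (vandermonde_of x T) = diff_prod x T.
Proof.
rewrite det_tr det_Vandermonde /diff_prod.
apply: eq_bigr => i _; apply: eq_bigr => j _; by rewrite !mxE.
Qed.

Theorem theorem2p2 (R : realType) (q : nat)
    (alpha beta x : 'I_(2 * q) -> R[i]) :
  \det (block_vandermonde alpha beta x) =
    \sum_(T : {set 'I_(2 * q)} | #|T| == q)
      eps R[i] T * (\prod_(i in T) alpha i) * (\prod_(j in ~: T) beta j)
        * \det (vandermonde_of x T) * \det (vandermonde_of x (~: T))
  /\
  \det (block_vandermonde alpha beta x) =
    \sum_(T : {set 'I_(2 * q)} | #|T| == q)
      eps R[i] T * (\prod_(i in T) alpha i) * (\prod_(j in ~: T) beta j)
        * diff_prod x T * diff_prod x (~: T).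
Proof.
have detE : \det (block_vandermonde alpha beta x) =
    \sum_(T : {set 'I_(2 * q)} | #|T| == q)
      eps R[i] T * (\prod_(i in T) alpha i) * (\prod_(j in ~: T) beta j)
        * \det (vandermonde_of x T) * \det (vandermonde_of x (~: T)).
  rewrite (@det_laplace _ _ _ (fun i j => alpha i * x i ^+ j)
             (fun i j => beta i * x i ^+ j)); last by rewrite leq_pmull.
  apply: eq_bigr => T _; rewrite !det_scaled_powers !mulrA; congr (_ * _).
  by rewrite mulrAC.
split=> //; rewrite detE; apply: eq_bigr => T _.
by rewrite !det_vandermonde_of.
Qed.
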